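(* Let $\Gamma$ be a typing context and $P$ a process. If $\Gamma\vdash P$ and $\mathsf{un}(\Gamma)$, then $P$ is safe.
   Context: The setting is a synchronous session-typed $\pi$-calculus with assume/assert and linear refinements. Syntax. Values: $v ::= x \mid ()$. Formulae: $\varphi ::= A(v_1,\dots,v_n) \mid \varphi\otimes\varphi \mid \mathbf 1$, with $A$ ranging over uninterpreted predicate symbols; formulae $A(v_1,\dots,v_n)$ are atomic. Processes: $P ::= x\langle v\rangle.P \mid x(y).P \mid P\mid P \mid {*}P \mid \mathbf 0 \mid (\nu xy\colon T)P \mid (\mathsf{assume}\ \varphi)P \mid \mathsf{assert}\ \varphi.P$. Qualifiers $q::=\mathsf{lin}\mid\mathsf{un}$; session types $p ::= ?x\colon T.T \mid !x\colon T.T$; types $T ::= \mathsf{unit}\mid\mathsf{end}\mid q\,p\mid \{x\colon T\mid\varphi\}\mid\alpha\mid\mu\alpha.T$ (contractive, and no subterm $\mu\alpha_1\dots\mu\alpha_n.\{x\colon T\mid\varphi\}$). Contexts: $\Gamma ::= \cdot \mid \Gamma,x\colon T\mid \Gamma,\varphi$ (ordered); $\operatorname{dom}(\Gamma)=\{x\mid x\colon T\in\Gamma\}$. Binders: $y$ in $x(y).P$; $x,y$ in $(\nu xy\colon T)P$; $y$ in $U$ within $q?y\colon T.U$, $q!y\colon T.U$; $x$ in $\varphi$ within $\{x\colon T\mid\varphi\}$; $\alpha$ in $\mu\alpha.T$. $\mathrm{fv}$ = free variables; $\{v/x\}$ = capture-avoiding substitution. Alpha-conversion and Barendregt's variable convention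 are assumed; the usual side conditions on bound variables are left implicit and taken to be guaranteed by this convention. Equivalence: on formulae the smallest equivalence with $\varphi_1\otimes\varphi_2\equiv\varphi_2\otimes\varphi_1$, $\varphi\otimes\mathbf 1\equiv\varphi$; on types a coinductive equivalence identifying $\mu\alpha.T$ with $T\{\mu\alpha.T/\alpha\}$ and refinement types differing only in equivalent formulae. Heating $P\Rrightarrow Q$ ($P\equiv Q$ meaning both directions), generated (reflexive, transitive, closed under process constructors as is standard) by: $P\mid Q\equiv Q\mid P$; $(P\mid Q)\mid R\equiv P\mid(Q\mid R)$; $P\mid\mathbf 0\equiv P$; ${*}P\equiv P\mid{*}P$; $(\nu xy\colon T)\mathbf 0\equiv\mathbf 0$; $(\nu xy\colon T)(P\mid Q)\equiv(\nu xy\colon T)P\mid Q$; $(\nu wz\colon T)(\nu xy\colon U)P\equiv(\nu xy\colon U)(\nu wz\colon T)P$; $(\nu xy\colon T)(\mathsf{assume}\ \varphi)P\equiv(\mathsf{assume}\ \varphi)(\nu xy\colon T)P$; $(\mathsf{assume}\ \mathbf 1)P\equiv P$; $\mathsf{assert}\ \mathbf 1.P\equiv P$; $(\mathsf{assume}\ \varphi_1)(\mathsf{assume}\ \varphi_2)P\equiv(\mathsf{assume}\ \varphi_2)(\mathsf{assume}\ \varphi_1)P$; $\mathsf{assert}\ \varphi_1.\mathsf{assert}\ \varphi_2.P\equiv\mathsf{assert}\ \varphi_2.\mathsf{assert}\ \varphi_1.P$; $\mathsf{assert}\ \varphi_1\otimes\varphi_2.P\equiv\mathsf{assert}\ \varphi_1.\mathsf{assert}\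 \varphi_2.P$; $(\mathsf{assume}\ \varphi_1\otimes\varphi_2)P\equiv(\mathsf{assume}\ \varphi_1)(\mathsf{assume}\ \varphi_2)P$; $(\mathsf{assume}\ \varphi)P\mid Q\Rrightarrow(\mathsf{assume}\ \varphi)(P\mid Q)$ (one direction only); $(\nu xy\colon T)P\equiv(\nu xy\colon U)P$ if $T\equiv U$. Safety. A process is in canonical form if it is $(\nu x_1y_1\colon T_1)\cdots(\nu x_ky_k\colon T_k)(\mathsf{assume}\ A_1)\cdots(\mathsf{assume}\ A_m)(P_1\mid\cdots\mid P_n)$ with $k,m\ge 0$, $n>0$, the $A_j$ atomic formulae, and each $P_i$ neither a restriction, nor an assume, nor a parallel composition. A process $Q$ is safe if for every process $P$ in canonical form (as displayed) with $Q\Rrightarrow P$, and every $i$ such that $P_i$ has the form $\mathsf{assert}\ B_i.R_i$ with $B_i$ atomic, there is $1\le j\le m$ with $B_i=A_j$. Duality: $\overline{q?x\colon T.U}=q!x\colon T.\overline U$, $\overline{q!x\colon T.U}=q?x\colon T.\overline U$, $\overline{\mathsf{end}}=\mathsf{end}$, $\overline{\mu\alpha.T}=\mu\alpha.\overline T$, $\overline\alpha=\alpha$. Unrestricted: $\mathsf{un}(\mathsf{unit})$, $\mathsf{un}(\mathsf{end})$, $\mathsf{un}(\mathsf{un}\,p)$; $\mathsf{un}(\cdot)$, $\mathsf{un}(\Gamma,x\colon T)$ if $\mathsf{un}(\Gamma)$ and $\mathsf{un}(T)$ (so unrestricted contexts contain no formulae). Well-formedness: $\Gamma\vdash_{wf}\varphi$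 iff $\mathrm{fv}(\varphi)\subseteq\operatorname{dom}(\Gamma)$; $\Gamma\vdash_{wf}T$ iff $\mathrm{fv}(T)\subseteq\operatorname{dom}(\Gamma)$; $\vdash_{wf}\cdot$; $\vdash_{wf}\Gamma,x\colon T$ if $\vdash_{wf}\Gamma$, $\Gamma\vdash_{wf}T$; $\vdash_{wf}\Gamma,\varphi$ if $\vdash_{wf}\Gamma$, $\Gamma\vdash_{wf}\varphi$. Context split $\Gamma=\Gamma_1\circ\Gamma_2$: $\cdot=\cdot\circ\cdot$; $\Gamma,x\colon\mathsf{lin}\,p=(\Gamma_1,x\colon\mathsf{lin}\,p)\circ\Gamma_2$ if $\Gamma=\Gamma_1\circ\Gamma_2$, $\Gamma_1\vdash_{wf}\mathsf{lin}\,p$ (and symmetrically into $\Gamma_2$ if $\Gamma_2\vdash_{wf}\mathsf{lin}\,p$); $\Gamma,x\colon T=(\Gamma_1,x\colon T)\circ(\Gamma_2,x\colon T)$ if $\Gamma=\Gamma_1\circ\Gamma_2$, $\mathsf{un}(T)$; $\Gamma,\varphi=(\Gamma_1,\varphi)\circ\Gamma_2$ if $\Gamma=\Gamma_1\circ\Gamma_2$, $\Gamma_1\vdash_{wf}\varphi$ (and symmetrically into $\Gamma_2$). Context update: $\Gamma+x\colon T=\Gamma,x\colon T$ if $x\notin\operatorname{dom}(\Gamma)$, $\Gamma\vdash_{wf}T$; $(\Gamma,x\colon T)+x\colon T=(\Gamma,x\colon T)$ if $\mathsf{un}(T)$. Typing (a context $\Gamma_1\circ\Gamma_2$ in a rule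 stands for any $\Gamma$ with $\Gamma=\Gamma_1\circ\Gamma_2$). Formulae: $\Gamma\vdash\mathbf 1$ if $\vdash_{wf}\Gamma$, $\mathsf{un}(\Gamma)$; $\Gamma_1,\varphi,\Gamma_2\vdash\varphi$ if $\vdash_{wf}\Gamma_1,\varphi,\Gamma_2$, $\mathsf{un}(\Gamma_1,\Gamma_2)$; $\Gamma_1\circ\Gamma_2\vdash\varphi_1\otimes\varphi_2$ if $\Gamma_i\vdash\varphi_i$. Values: $\Gamma\vdash()\colon\mathsf{unit}$ if $\vdash_{wf}\Gamma$, $\mathsf{un}(\Gamma)$; $\Gamma_1,x\colon T,\Gamma_2\vdash x\colon T$ if $\vdash_{wf}\Gamma_1,x\colon T,\Gamma_2$, $\mathsf{un}(\Gamma_1,\Gamma_2)$; $\Gamma_1\circ\Gamma_2\vdash v\colon\{x\colon T\mid\varphi\}$ if $\Gamma_1\vdash\varphi\{v/x\}$, $\Gamma_2\vdash v\colon T$; $\Gamma\vdash v\colon T_2$ if $\Gamma\vdash v\colon T_1$, $T_1\equiv T_2$. Processes: $\Gamma\vdash\mathbf 0$ if $\vdash_{wf}\Gamma$, $\mathsf{un}(\Gamma)$; $\Gamma_1\circ\Gamma_2\vdash P_1\mid P_2$ if $\Gamma_i\vdash P_i$; $\Gamma\vdash(\nu xy\colon T)P$ if $\Gamma\vdash_{wf}T$ and $\Gamma,x\colon T,y\colon\overline T\vdash P$; $\Gamma\vdash{*}P$ if $\mathsf{un}(\Gamma)$, $\Gamma\vdash P$; $\Gamma_1\circ\Gamma_2\circ\Gamma_3\vdash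 x\langle v\rangle.P$ if $\Gamma_1\vdash x\colon(q\,!y\colon T.U)$, $\Gamma_2\vdash v\colon T$, $\Gamma_3+x\colon U\{v/y\}\vdash P$; $\Gamma_1\circ\Gamma_2\vdash x(z).P$ if $\Gamma_1\vdash x\colon(q\,?y\colon T.U)$ and $(\Gamma_2,z\colon T)+x\colon U\{z/y\}\vdash P$; $\Gamma_1\vdash(\mathsf{assume}\ \varphi)P$ if $\Gamma_2\vdash\varphi$ and $\Gamma\vdash P$ for some $\Gamma=\Gamma_1\circ\Gamma_2$; $\Gamma_1\circ\Gamma_2\vdash\mathsf{assert}\ \varphi.P$ if $\Gamma_1\vdash\varphi$, $\Gamma_2\vdash P$; $\Gamma,\mathbf 1\vdash P$ if $\Gamma\vdash P$; $\Gamma_1,\varphi_1\otimes\varphi_2,\Gamma_2\vdash P$ if $\Gamma_1,\varphi_1,\varphi_2,\Gamma_2\vdash P$; $\Gamma_1,x\colon\{y\colon T\mid\varphi\},\Gamma_2\vdash P$ if $\Gamma_1,x\colon T,\varphi\{x/y\},\Gamma_2\vdash P$. *)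

(* Defs.v *)
From mathcomp Require Import all_boot.

Set Implicit Arguments.
Unset Strict Implicit.
Unset Printing Implicit Defensive.

(* Terms are taken up to alpha-conversion by means of nested abstract syntax:
   a term over [V] has its free variables in [V], and a binder over [V] has a
   body over [option V], [None] being the bound variable.  The objects of the
   calculus are the terms over [name]; binders are written with names through
   the abstraction maps [abs1] and [abs2] below. *)
Definition name := nat.
Definition psym := nat.

Inductive value (V : Type) : Type :=
| VVar (x : V)
| VUnit.
Arguments VUnit {V}.

Inductive form (V : Type) : Type :=
| FAtom (A : psym) (vs : seq (value V))
| FTensor (phi1 phi2 : form V)
| FOne.
Arguments FOne {V}.

Inductive qual : Type := Lin | Un.
Inductive dir : Type := Recv | Send.

(* [TSess q Recv T U] is [q ?y:T.U] and [TSess q Send T U] is [q !y:T.U].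
   The parameter [A] is the set of free recursion variables. *)
Inductive ty (V A : Type) : Type :=
| TUnit
| TEnd
| TSess (q : qual) (d : dir) (T : ty V A) (U : ty (option V) A)
| TRef (T : ty V A) (phi : form (option V))
| TVar (a : A)
| TMu (T : ty V (option A)).
Arguments TUnit {V A}.
Arguments TEnd {V A}.
Arguments TVar {V A} a.

(* In [PNu T P], i.e. [(nu xy : T) P], the variable y is [None] and x is
   [Some None]; neither scopes over [T]. *)
Inductive proc (V : Type) : Type :=
| POut (x : V) (v : value V) (P : proc V)
| PIn (x : V) (P : proc (option V))
| PPar (P Q : proc V)
| PRep (P : proc V)
| PNil
| PNu (T : ty V void) (P : proc (option (option V)))
| PAssume (phi : form V) (P : proc V)
| PAssert (phi : form V) (P : proc V).
Arguments PNil {V}.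

Definition val_subst V W (s : V -> value W) (v : value V) : value W :=
  if v is VVar x then s x else VUnit.

Fixpoint form_subst V W (s : V -> value W) (phi : form V) : form W :=
  match phi with
  | FAtom A vs => FAtom A (map (val_subst s) vs)
  | FTensor phi1 phi2 => FTensor (form_subst s phi1) (form_subst s phi2)
  | FOne => FOne
  end.

Definition val_map V W (f : V -> W) : value V -> value W :=
  val_subst (fun x => VVar (f x)).

Definition form_map V W (f : V -> W) : form V -> form W :=
  form_subst (fun x => VVar (f x)).

Definition up_subst V W (s : V -> value W) (o : option V) : value (option W) :=
  if o is Some x then val_map Some (s x) else VVar None.

Fixpoint ty_map V W A B (f : V -> W) (g : A -> B) (T : ty V A) : ty W B :=
  match T with
  | TUnit => TUnit
  | TEnd => TEnd
  | TSess q d T U => TSess q d (ty_map f g T) (ty_map (omap f) g U)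
  | TRef T phi => TRef (ty_map f g T) (form_map (omap f) phi)
  | TVar a => TVar (g a)
  | TMu T => TMu (ty_map f (omap g) T)
  end.

Fixpoint ty_subst V W A (s : V -> value W) (T : ty V A) : ty W A :=
  match T with
  | TUnit => TUnit
  | TEnd => TEnd
  | TSess q d T U => TSess q d (ty_subst s T) (ty_subst (up_subst s) U)
  | TRef T phi => TRef (ty_subst s T) (form_subst (up_subst s) phi)
  | TVar a => TVar a
  | TMu T => TMu (ty_subst s T)
  end.

Definition up_tsubst V A B (s : A -> ty V B) (o : option A) :
    ty V (option B) :=
  if o is Some a then ty_map id Some (s a) else TVar None.

Fixpoint ty_tsubst V A B (s : A -> ty V B) (T : ty V A) : ty V B :=
  match T with
  | TUnit => TUnit
  | TEnd => TEnd
  | TSess q d T U =>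
      TSess q d (ty_tsubst s T) (ty_tsubst (fun a => ty_map Some id (s a)) U)
  | TRef T phi => TRef (ty_tsubst s T) phi
  | TVar a => s a
  | TMu T => TMu (ty_tsubst (up_tsubst s) T)
  end.

Fixpoint proc_map V W (f : V -> W) (P : proc V) : proc W :=
  match P with
  | POut x v P => POut (f x) (val_map f v) (proc_map f P)
  | PIn x P => PIn (f x) (proc_map (omap f) P)
  | PPar P Q => PPar (proc_map f P) (proc_map f Q)
  | PRep P => PRep (proc_map f P)
  | PNil => PNil
  | PNu T P => PNu (ty_map f id T) (proc_map (omap (omap f)) P)
  | PAssume phi P => PAssume (form_map f phi) (proc_map f P)
  | PAssert phi P => PAssert (form_map f phi) (proc_map f P)
  end.

Definition inst V (v : value V) (o : option V) : value V :=
  if o is Some x then VVar x else v.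

(* [form_inst phi v] is [phi{v/y}] and [ty_inst U v] is [U{v/y}], where y is
   the variable [None] of [phi] and of [U]. *)
Definition form_inst V (phi : form (option V)) (v : value V) : form V :=
  form_subst (inst v) phi.

Definition ty_inst V A (U : ty (option V) A) (v : value V) : ty V A :=
  ty_subst (inst v) U.

(* [T{mu a.T / a}] *)
Definition unfold_mu V A (T : ty V (option A)) : ty V A :=
  ty_tsubst (fun o => if o is Some a then TVar a else TMu T) T.

Definition abs1 (z w : name) : option name :=
  if w == z then None else Some w.

Definition abs2 (x y w : name) : option (option name) :=
  if w == y then None else if w == x then Some None else Some (Some w).

Definition p_in (x z : name) (P : proc name) : proc name :=
  PIn x (proc_map (abs1 z) P).

Definition p_nu (x y : name) (T : ty name void) (P : proc name) : proc name :=
  PNu T (proc_map (abs2 x y) P).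

Definition fv_val V (v : value V) : seq V := if v is VVar x then [:: x] else [::].

Fixpoint fv_form V (phi : form V) : seq V :=
  match phi with
  | FAtom _ vs => flatten (map (@fv_val V) vs)
  | FTensor phi1 phi2 => fv_form phi1 ++ fv_form phi2
  | FOne => [::]
  end.

Fixpoint fv_ty V A (T : ty V A) : seq V :=
  match T with
  | TUnit | TEnd | TVar _ => [::]
  | TSess _ _ T U => fv_ty T ++ pmap id (fv_ty U)
  | TRef T phi => fv_ty T ++ pmap id (fv_form phi)
  | TMu T => fv_ty T
  end.

Fixpoint fv_proc V (P : proc V) : seq V :=
  match P with
  | POut x v P => x :: fv_val v ++ fv_proc P
  | PIn x P => x :: pmap id (fv_proc P)
  | PPar P Q => fv_proc P ++ fv_proc Q
  | PRep P => fv_proc P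
  | PNil => [::]
  | PNu T P => fv_ty T ++ pmap id (pmap id (fv_proc P))
  | PAssume phi P | PAssert phi P => fv_form phi ++ fv_proc P
  end.

(* [T] is [mu a1 ... mu an. a], n >= 0, with [p a] ([a] not among the [ai]). *)
Fixpoint mu_var V A (p : A -> bool) (T : ty V A) : bool :=
  match T with
  | TVar a => p a
  | TMu T => mu_var (fun o => if o is Some a then p a else false) T
  | _ => false
  end.

(* [T] is [mu a1 ... mu an. {x:U | phi}], n >= 0. *)
Fixpoint mu_ref V A (T : ty V A) : bool :=
  match T with
  | TRef _ _ => true
  | TMu T => mu_ref T
  | _ => false
  end.

(* Contractive, and without subterms [mu a1 ... mu an. {x:U | phi}], n >= 1. *)
Fixpoint is_type V A (T : ty V A) : bool :=
  match T with
  | TUnit | TEnd | TVar _ => true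
  | TSess _ _ T U => is_type T && is_type U
  | TRef T _ => is_type T
  | TMu T => [&& ~~ mu_var (fun o => ~~ isSome o) T, ~~ mu_ref T & is_type T]
  end.

Inductive form_equiv V : form V -> form V -> Prop :=
| fe_refl phi : form_equiv phi phi
| fe_sym phi psi : form_equiv phi psi -> form_equiv psi phi
| fe_trans phi psi chi :
    form_equiv phi psi -> form_equiv psi chi -> form_equiv phi chi
| fe_comm phi psi : form_equiv (FTensor phi psi) (FTensor psi phi)
| fe_one phi : form_equiv (FTensor phi FOne) phi.

CoInductive ty_bisim : forall V, ty V void -> ty V void -> Prop :=
| te_unit V : @ty_bisim V TUnit TUnit
| te_end V : @ty_bisim V TEnd TEnd
| te_sess V q d (T T' : ty V void) (U U' : ty (option V) void) :
    ty_bisim T T' -> ty_bisim U U' ->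
    ty_bisim (TSess q d T U) (TSess q d T' U')
| te_ref V (T T' : ty V void) (phi phi' : form (option V)) :
    ty_bisim T T' -> form_equiv phi phi' ->
    ty_bisim (TRef T phi) (TRef T' phi')
| te_mul V (T : ty V (option void)) (U : ty V void) :
    ty_bisim (unfold_mu T) U -> ty_bisim (TMu T) U
| te_mur V (T : ty V void) (U : ty V (option void)) :
    ty_bisim T (unfold_mu U) -> ty_bisim T (TMu U).

(* Contractivity of both sides makes the coinductive reading of [te_mul] and
   [te_mur] sound: it rules out infinite chains of unfoldings. *)
Definition ty_equiv V (T U : ty V void) : Prop :=
  [/\ is_type T, is_type U & ty_bisim T U].

Definition flip (d : dir) : dir := if d is Recv then Send else Recv.

(* Duality is undefined on unit and on refinement types. *)
Fixpoint dual V A (T : ty V A) : option (ty V A) :=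
  match T with
  | TEnd => Some TEnd
  | TSess q d T U => omap (TSess q (flip d) T) (dual U)
  | TVar a => Some (TVar a)
  | TMu T => omap (@TMu V A) (dual T)
  | TUnit | TRef _ _ => None
  end.

Definition un_ty V A (T : ty V A) : bool :=
  match T with
  | TUnit | TEnd | TSess Un _ _ _ => true
  | _ => false
  end.

Inductive struct_ax : proc name -> proc name -> Prop :=
| sa_parC P Q : struct_ax (PPar P Q) (PPar Q P)
| sa_parA P Q R : struct_ax (PPar (PPar P Q) R) (PPar P (PPar Q R))
| sa_par0 P : struct_ax (PPar P PNil) P
| sa_rep P : struct_ax (PRep P) (PPar P (PRep P))
| sa_nu0 x y (T : ty name void) : is_type T -> struct_ax (p_nu x y T PNil) PNil
| sa_nu_par (x y : name) T P (Q : proc name) :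
    x \notin fv_proc Q -> y \notin fv_proc Q ->
    struct_ax (p_nu x y T (PPar P Q)) (PPar (p_nu x y T P) Q)
| sa_nuC (w z x y : name) (T U : ty name void) P :
    ~~ has (mem [:: x; y]) [:: w; z] ->
    ~~ has (mem [:: x; y]) (fv_ty T) ->
    ~~ has (mem [:: w; z]) (fv_ty U) ->
    struct_ax (p_nu w z T (p_nu x y U P)) (p_nu x y U (p_nu w z T P))
| sa_nu_assume (x y : name) T (phi : form name) P :
    x \notin fv_form phi -> y \notin fv_form phi ->
    struct_ax (p_nu x y T (PAssume phi P)) (PAssume phi (p_nu x y T P))
| sa_assume1 P : struct_ax (PAssume FOne P) P
| sa_assert1 P : struct_ax (PAssert FOne P) P
| sa_assumeC phi1 phi2 P :
    struct_ax (PAssume phi1 (PAssume phi2 P)) (PAssume phi2 (PAssume phi1 P))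
| sa_assertC phi1 phi2 P :
    struct_ax (PAssert phi1 (PAssert phi2 P)) (PAssert phi2 (PAssert phi1 P))
| sa_assert_tensor phi1 phi2 P :
    struct_ax (PAssert (FTensor phi1 phi2) P) (PAssert phi1 (PAssert phi2 P))
| sa_assume_tensor phi1 phi2 P :
    struct_ax (PAssume (FTensor phi1 phi2) P) (PAssume phi1 (PAssume phi2 P))
| sa_nu_ty x y T U P :
    ty_equiv T U -> struct_ax (p_nu x y T P) (p_nu x y U P).

Inductive heat : proc name -> proc name -> Prop :=
| h_refl P : heat P P
| h_trans P Q R : heat P Q -> heat Q R -> heat P R
| h_ax P Q : struct_ax P Q -> heat P Q
| h_axV P Q : struct_ax P Q -> heat Q P
| h_assume_par phi P Q :
    heat (PPar (PAssume phi P) Q) (PAssume phi (PPar P Q))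
| h_out x v P Q : heat P Q -> heat (POut x v P) (POut x v Q)
| h_in x z P Q : heat P Q -> heat (p_in x z P) (p_in x z Q)
| h_par P P' Q Q' : heat P P' -> heat Q Q' -> heat (PPar P Q) (PPar P' Q')
| h_rep P Q : heat P Q -> heat (PRep P) (PRep Q)
| h_nu x y T P Q : heat P Q -> heat (p_nu x y T P) (p_nu x y T Q)
| h_assume phi P Q : heat P Q -> heat (PAssume phi P) (PAssume phi Q)
| h_assert phi P Q : heat P Q -> heat (PAssert phi P) (PAssert phi Q).

Definition atomic V (phi : form V) : bool :=
  if phi is FAtom _ _ then true else false.

Definition is_thread V (P : proc V) : bool :=
  match P with
  | PNu _ _ | PAssume _ _ | PPar _ _ => false
  | _ => true
  end.

Definition par_seq V (Ps : seq (proc V)) : proc V :=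
  if Ps is P :: Ps' then foldl (@PPar V) P Ps' else PNil.

Definition restriction : Type := (name * name * ty name void)%type.

Definition nu_seq (bs : seq restriction) (P : proc name) : proc name :=
  foldr (fun b Q => p_nu b.1.1 b.1.2 b.2 Q) P bs.

Definition canonical (bs : seq restriction) (As : seq (form name))
    (Ps : seq (proc name)) (P : proc name) : Prop :=
  [/\ all (@atomic name) As, 0 < size Ps, all (@is_thread name) Ps
    & P = nu_seq bs (foldr (@PAssume name) (par_seq Ps) As)].

Definition safe (Q : proc name) : Prop :=
  forall P bs As Ps, heat Q P -> canonical bs As Ps P ->
  forall i B R, onth Ps i = Some (PAssert B R) -> atomic B ->
  exists j, onth As j = Some B.

Inductive entry : Type :=
| EVar (x : name) (T : ty name void)
| EForm (phi : form name).

(* A context is stored with its rightmost entry first. *)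
Definition ctx : Type := seq entry.

Definition add_var (G : ctx) (x : name) (T : ty name void) : ctx :=
  EVar x T :: G.
Definition add_form (G : ctx) (phi : form name) : ctx := EForm phi :: G.
Definition append (G1 G2 : ctx) : ctx := G2 ++ G1.

Definition dom (G : ctx) : seq name :=
  pmap (fun e => if e is EVar x _ then Some x else None) G.

Definition ctx_vars (G : ctx) : seq name :=
  flatten
    (map (fun e => match e with
                   | EVar x T => x :: fv_ty T
                   | EForm phi => fv_form phi
                   end) G).

Definition un_ctx (G : ctx) : bool :=
  all (fun e => if e is EVar _ T then un_ty T else false) G.

Definition wf_form (G : ctx) (phi : form name) : Prop :=
  {subset fv_form phi <= dom G}.

Definition wf_ty (G : ctx) (T : ty name void) : Prop :=
  is_type T /\ {subset fv_ty T <= dom G}.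

Inductive wf_ctx : ctx -> Prop :=
| wf_nil : wf_ctx [::]
| wf_var G x T : wf_ctx G -> wf_ty G T -> wf_ctx (add_var G x T)
| wf_frm G phi : wf_ctx G -> wf_form G phi -> wf_ctx (add_form G phi).

(* [ctx_split G G1 G2] is [G = G1 o G2]. *)
Inductive ctx_split : ctx -> ctx -> ctx -> Prop :=
| sp_nil : ctx_split [::] [::] [::]
| sp_linl G G1 G2 x d T U :
    ctx_split G G1 G2 -> wf_ty G1 (TSess Lin d T U) ->
    ctx_split (add_var G x (TSess Lin d T U)) (add_var G1 x (TSess Lin d T U)) G2
| sp_linr G G1 G2 x d T U :
    ctx_split G G1 G2 -> wf_ty G2 (TSess Lin d T U) ->
    ctx_split (add_var G x (TSess Lin d T U)) G1 (add_var G2 x (TSess Lin d T U))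
| sp_un G G1 G2 x T :
    ctx_split G G1 G2 -> un_ty T ->
    ctx_split (add_var G x T) (add_var G1 x T) (add_var G2 x T)
| sp_forml G G1 G2 phi :
    ctx_split G G1 G2 -> wf_form G1 phi ->
    ctx_split (add_form G phi) (add_form G1 phi) G2
| sp_formr G G1 G2 phi :
    ctx_split G G1 G2 -> wf_form G2 phi ->
    ctx_split (add_form G phi) G1 (add_form G2 phi).

(* [update G x T G'] is [G + x:T = G']. *)
Inductive update : ctx -> name -> ty name void -> ctx -> Prop :=
| up_new G x T : x \notin dom G -> wf_ty G T -> update G x T (add_var G x T)
| up_un G x T : un_ty T -> update (add_var G x T) x T (add_var G x T).

Inductive has_form : ctx -> form name -> Prop :=
| tf_one G : wf_ctx G -> un_ctx G -> has_form G FOne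
| tf_ax G1 G2 phi :
    wf_ctx (append (add_form G1 phi) G2) -> un_ctx (append G1 G2) ->
    has_form (append (add_form G1 phi) G2) phi
| tf_tensor G G1 G2 phi1 phi2 :
    ctx_split G G1 G2 -> has_form G1 phi1 -> has_form G2 phi2 ->
    has_form G (FTensor phi1 phi2).

Inductive has_val : ctx -> value name -> ty name void -> Prop :=
| tv_unit G : wf_ctx G -> un_ctx G -> has_val G VUnit TUnit
| tv_var G1 G2 x T :
    wf_ctx (append (add_var G1 x T) G2) -> un_ctx (append G1 G2) ->
    has_val (append (add_var G1 x T) G2) (VVar x) T
| tv_ref G G1 G2 v T phi :
    ctx_split G G1 G2 -> has_form G1 (form_inst phi v) -> has_val G2 v T ->
    has_val G v (TRef T phi)
| tv_equiv G v T1 T2 : has_val G v T1 -> ty_equiv T1 T2 -> has_val G v T2.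

(* The premises [_ \notin ctx_vars G] are the variable convention for the
   variables bound in the process of the conclusion. *)
Inductive typed : ctx -> proc name -> Prop :=
| tp_nil G : wf_ctx G -> un_ctx G -> typed G PNil
| tp_par G G1 G2 P1 P2 :
    ctx_split G G1 G2 -> typed G1 P1 -> typed G2 P2 -> typed G (PPar P1 P2)
| tp_nu G x y T T' P :
    x != y -> x \notin ctx_vars G -> y \notin ctx_vars G ->
    wf_ty G T -> dual T = Some T' ->
    typed (add_var (add_var G x T) y T') P ->
    typed G (p_nu x y T P)
| tp_rep G P : un_ctx G -> typed G P -> typed G (PRep P)
| tp_out G G12 G1 G2 G3 G3' q x v T U P :
    ctx_split G G12 G3 -> ctx_split G12 G1 G2 ->
    has_val G1 (VVar x) (TSess q Send T U) ->
    has_val G2 v T ->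
    update G3 x (ty_inst U v) G3' -> typed G3' P ->
    typed G (POut x v P)
| tp_in G G1 G2 G2' q x z T U P :
    z \notin ctx_vars G ->
    ctx_split G G1 G2 ->
    has_val G1 (VVar x) (TSess q Recv T U) ->
    update (add_var G2 z T) x (ty_inst U (VVar z)) G2' -> typed G2' P ->
    typed G (p_in x z P)
| tp_assume G G1 G2 phi P :
    ctx_split G G1 G2 -> has_form G2 phi -> typed G P ->
    typed G1 (PAssume phi P)
| tp_assert G G1 G2 phi P :
    ctx_split G G1 G2 -> has_form G1 phi -> typed G2 P ->
    typed G (PAssert phi P)
| tp_one G P : typed G P -> typed (add_form G FOne) P
| tp_tensor G1 G2 phi1 phi2 P :
    typed (append (add_form (add_form G1 phi1) phi2) G2) P ->
    typed (append (add_form G1 (FTensor phi1 phi2)) G2) P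
| tp_ref G1 G2 x T phi P :
    typed (append (add_form (add_var G1 x T) (form_inst phi (VVar x))) G2) P ->
    typed (append (add_var G1 x (TRef T phi)) G2) P.

(* Main.v *)
Require Import Defs.
From HB Require Import structures.
From mathcomp Require Import all_boot zify.

(** Only unguarded code can be heated into a thread of a canonical form, so it
    is enough to follow the formulae of unguarded assumes and asserts.  For an
    atom [a], let [need P a] be the number of copies of [a] that [P] must be
    given by its environment: asserts add to it, assumes subtract from it
    (truncated at 0), prefixes stop it.  Call [P] balanced if no replicated
    process needs anything and no restriction hides a needed atom.  Heating
    preserves being balanced and never increases [need].  A process typed in
    [G] is balanced and needs at most the atoms that occur in the formulae of
    [G], the refinements of its variables included: none if [un_ctx G].  In a
    canonical form that needs nothing, every atom asserted by a thread must be
    cancelled by one of the assumes. *)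

Set Implicit Arguments.
Unset Strict Implicit.
Unset Printing Implicit Defensive.

(** * Atoms, needs and balance *)

Definition value_option V (v : value V) : option V :=
  if v is VVar x then Some x else None.

Definition option_value V (o : option V) : value V :=
  if o is Some x then VVar x else VUnit.

Lemma value_optionK V : cancel (@value_option V) (@option_value V).
Proof. by case. Qed.

HB.instance Definition _ (V : eqType) :=
  Equality.copy (value V) (can_type (@value_optionK V)).

(** Kept as a pair rather than a formula, so that equality of atoms is inherited from [value]. *)
Definition atom (V : Type) : Type := (psym * seq (value V))%type.

Definition atom_map V W (f : V -> W) (a : atom V) : atom W :=
  (a.1, map (val_map f) a.2).

Definition fv_atom V (a : atom V) : seq V := flatten (map (@fv_val V) a.2).

Notation shift2 := (fun x => Some (Some x)).

Fixpoint atom_count (V : eqType) (a : atom V) (phi : form V) : nat :=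
  match phi with
  | FAtom A vs => ((A, vs) : atom V) == a
  | FTensor phi1 phi2 => atom_count a phi1 + atom_count a phi2
  | FOne => 0
  end.

(** A restriction is read only at atoms of its environment, weakened under the two binders, and a
    replication counts 0; what this would hide is excluded by [balanced]. *)
Fixpoint need (V : eqType) (P : proc V) (a : atom V) {struct P} : nat :=
  match P with
  | PPar P Q => need P a + need Q a
  | PNu _ P => @need (option (option V)) P (atom_map shift2 a)
  | PAssume phi P => need P a - atom_count a phi
  | PAssert phi P => need P a + atom_count a phi
  | _ => 0
  end.

Fixpoint balanced (V : eqType) (P : proc V) : Prop :=
  match P with
  | PPar P Q => balanced P /\ balanced Q
  | PRep P => balanced P /\ forall a, need P a = 0
  | PNu _ P =>
      @balanced (option (option V)) P /\
      forall a : atom (option (option V)),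
        0 < @need (option (option V)) P a ->
        exists b : atom V, a = atom_map shift2 b
  | PAssume _ P | PAssert _ P => balanced P
  | _ => True
  end.

(* The automatic scheme ranges over all types of variables; this one keeps them
   decidable below binders. *)
Lemma proc_eqType_ind (K : forall V : eqType, proc V -> Prop) :
  (forall V x v P, K V P -> K V (POut x v P)) ->
  (forall (V : eqType) (x : V) (P : proc (option V)),
     K (option V) P -> K V (PIn x P)) ->
  (forall V P Q, K V P -> K V Q -> K V (PPar P Q)) ->
  (forall V P, K V P -> K V (PRep P)) ->
  (forall V, K V PNil) ->
  (forall (V : eqType) T (P : proc (option (option V))),
     K (option (option V)) P -> K V (PNu T P)) ->
  (forall V phi P, K V P -> K V (PAssume phi P)) ->
  (forall V phi P, K V P -> K V (PAssert phi P)) ->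
  forall (V : eqType) (P : proc V), K V P.
Proof.
move=> Kout Kin Kpar Krep Knil Knu Kassume Kassert.
fix IH 2 => V [x v P|x P|P Q|P||T P|phi P|phi P].
- exact: Kout.
- exact: Kin.
- exact: Kpar.
- exact: Krep.
- exact: Knil.
- exact: Knu.
- exact: Kassume.
- exact: Kassert.
Qed.

(** * Renaming *)

Lemma val_map_inj V W (f : V -> W) : injective f -> injective (val_map f).
Proof. by move=> fI [x|] [y|] //= [/fI->]. Qed.

Lemma atom_map_inj V W (f : V -> W) : injective f -> injective (atom_map f).
Proof. by move=> fI [A vs] [B ws] [-> /(inj_map (val_map_inj fI))->]. Qed.

Lemma omap_inj V W (f : V -> W) : injective f -> injective (omap f).
Proof. by move=> fI [x|] [y|] //= [/fI->]. Qed.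

Lemma atom_map_shift2_omap V W (f : V -> W) (a : atom V) :
  atom_map (omap (omap f)) (atom_map shift2 a) =
  atom_map shift2 (atom_map f a).
Proof.
case: a => A vs; congr pair; rewrite /= -!map_comp.
by apply: eq_map => -[].
Qed.

(** The commuting square of weakening and renaming is a pullback: a renaming lifted under two
    binders fixes the bound variables and sends no other variable to them. *)
Lemma atom_map_shift2_omapP V W (f : V -> W) (a : atom (option (option V)))
    (b : atom W) :
  atom_map (omap (omap f)) a = atom_map shift2 b ->
  exists2 c : atom V, a = atom_map shift2 c & b = atom_map f c.
Proof.
case: a b => A vs [B ws] [-> {A} E].
suff [us -> ->] :
    exists2 us, vs = map (val_map shift2) us & ws = map (val_map f) us.
  by exists (B, us).
elim: vs ws E => [|v vs IHvs] [|w ws] //= => [_|[Ev Evs]]; first by exists [::].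
have [us -> ->] := IHvs _ Evs.
case: v w Ev => [[[x|]|]|] [y|] //= => [[<-]|_].
  by exists (VVar x :: us).
by exists (VUnit :: us).
Qed.

Lemma atom_count_map (V W : eqType) (f : V -> W) (a : atom V) phi :
  injective f -> atom_count (atom_map f a) (form_map f phi) = atom_count a phi.
Proof.
move=> fI; elim: phi => [A vs|phi1 IH1 phi2 IH2|] //=; last first.
  by congr addn.
by rewrite -(inj_eq (atom_map_inj fI) (A, vs) a).
Qed.

Lemma atom_count_map_gt0 (V W : eqType) (f : V -> W) (b : atom W) phi :
  0 < atom_count b (form_map f phi) -> exists a : atom V, b = atom_map f a.
Proof.
elim: phi => [A vs|phi1 IH1 phi2 IH2|] //=.
  by rewrite lt0b => /eqP <-; exists (A, vs).
by rewrite addn_gt0 => /orP[/IH1|/IH2].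
Qed.

(** Needed atoms come from formulae, all of which are renamed. For injective [f], this and
    [need_map] give the need of a renamed process at every atom. *)
Lemma need_map_gt0 (V W : eqType) (f : V -> W) (P : proc V) (b : atom W) :
  0 < need (proc_map f P) b -> exists a : atom V, b = atom_map f a.
Proof.
elim/proc_eqType_ind: V / P W f b => //=.
- move=> V P Q IHP IHQ W f b; rewrite addn_gt0 => /orP[/IHP|/IHQ] //.
- move=> V T P IHP W f b /(IHP (option (option W)))[a].
  by move/esym/atom_map_shift2_omapP => [c _ ->]; exists c.
- by move=> V phi P IHP W f b; rewrite subn_gt0 => /(leq_ltn_trans (leq0n _))/IHP.
- move=> V phi P IHP W f b; rewrite addn_gt0 => /orP[/IHP //|].
  exact: atom_count_map_gt0.
Qed.

Lemma need_map (V W : eqType) (f : V -> W) (P : proc V) (a : atom V) :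
  injective f -> need (proc_map f P) (atom_map f a) = need P a.
Proof.
move=> fI; elim/proc_eqType_ind: V / P W f fI a => //=.
- by move=> V P Q IHP IHQ W f fI a; rewrite IHP // IHQ.
- move=> V T P IHP W f fI a; rewrite -atom_map_shift2_omap.
  exact: (IHP (option (option W)) _ (omap_inj (omap_inj fI))).
- by move=> V phi P IHP W f fI a; rewrite IHP // atom_count_map.
- by move=> V phi P IHP W f fI a; rewrite IHP // atom_count_map.
Qed.

Lemma balanced_map (V W : eqType) (f : V -> W) (P : proc V) :
  injective f -> balanced (proc_map f P) <-> balanced P.
Proof.
move=> fI; elim/proc_eqType_ind: V / P W f fI => //=.
- by move=> V P Q IHP IHQ W f fI; rewrite IHP // IHQ.
- move=> V P IHP W f fI; rewrite IHP //; split=> -[bP P0]; split=> // a.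
    by rewrite -(need_map P a fI) P0.
  case: (posnP (need (proc_map f P) a)) => // /[dup] /need_map_gt0[c ->].
  by rewrite need_map // P0.
- move=> V T P IHP W f fI.
  have ffI := omap_inj (omap_inj fI).
  have := IHP (option (option W)) _ ffI; move=> ->.
  split=> -[bP closedP]; split=> // a a_gt0.
    have [] := closedP (atom_map (omap (omap f)) a).
      by rewrite (@need_map _ (option (option W))).
    by move=> b /atom_map_shift2_omapP[c -> _]; exists c.
  have [c ac] := @need_map_gt0 _ (option (option W)) _ _ _ a_gt0.
  move: a_gt0; rewrite ac (@need_map _ (option (option W))) // => /closedP[b ->].
  by rewrite atom_map_shift2_omap; exists (atom_map f b).
Qed.

(** * Free variables *)

Lemma fv_atom_shift2 (V : eqType) (x : V) (a : atom V) :
  x \in fv_atom a -> Some (Some x) \in fv_atom (atom_map shift2 a).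
Proof.
case: a => A vs; rewrite /fv_atom /=.
elim: vs => //= v vs IHvs; rewrite !mem_cat => /orP[|/IHvs->]; last exact: orbT.
by case: v => //= y; rewrite !inE => /eqP->; rewrite eqxx.
Qed.

Lemma mem_pmap_shift2 (V : eqType) (s : seq (option (option V))) (x : V) :
  Some (Some x) \in s -> x \in pmap id (pmap id s).
Proof. by rewrite !mem_pmap !map_id mem_pmap map_id. Qed.

Lemma atom_count_fv (V : eqType) (a : atom V) phi :
  0 < atom_count a phi -> {subset fv_atom a <= fv_form phi}.
Proof.
elim: phi => [A vs|phi1 IH1 phi2 IH2|] //=; first by rewrite lt0b => /eqP <-.
by rewrite addn_gt0 => /orP[/IH1|/IH2] sub x /sub; rewrite mem_cat => ->;
  rewrite ?orbT.
Qed.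

(* [fv_proc] is confined to variables in [Set], whence the unbundled [eqType]. *)
Lemma need_fv (V : Set) (c : Equality V) (P : proc V) (a : atom V) :
  let eV : eqType := Equality.Pack c in
  0 < @need eV P a ->
  {subset (fv_atom a : seq eV) <= (fv_proc P : seq eV)}.
Proof.
move: V c P a; fix IH 3 => V c [x v P|x P|P Q|P||T P|phi P|phi P] a eV //=.
- rewrite addn_gt0 => /orP[/IH|/IH] sub x /sub xP;
  by rewrite (@mem_cat eV) xP ?orbT.
- move=> a_gt0 x /(@fv_atom_shift2 eV) xa.
  pose oV : eqType := option (option eV).
  have xP := IH (option (option V)) (Equality.class oV) P _ a_gt0 _ xa.
  by rewrite (@mem_cat eV) (@mem_pmap_shift2 eV _ _ xP) orbT.
- rewrite subn_gt0 => /(leq_ltn_trans (leq0n _))/IH sub x.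
  by move/sub => xP; rewrite (@mem_cat eV) xP orbT.
- rewrite addn_gt0 => /orP[/IH|/(@atom_count_fv eV)] sub x /sub xP;
  by rewrite (@mem_cat eV) xP ?orbT.
Qed.

(** * Restriction *)

Definition fresh2 (x y : name) (a : atom name) : bool :=
  (x \notin fv_atom a) && (y \notin fv_atom a).

Lemma abs2_inj x y : injective (abs2 x y).
Proof.
move=> u w; rewrite /abs2.
by case: (u =P y); case: (w =P y); case: (u =P x); case: (w =P x); congruence.
Qed.

Lemma atom_map_abs2_fresh x y (a : atom name) :
  fresh2 x y a -> atom_map (abs2 x y) a = atom_map shift2 a.
Proof.
case: a => A vs; rewrite /fresh2 /fv_atom /= => fr; congr pair => /=.
elim: vs fr => //= v vs IHvs; rewrite !mem_cat !negb_or -!andbA.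
case/and4P=> xv xvs yv yvs; rewrite IHvs ?xvs //; congr cons.
case: v xv yv => //= z; rewrite !inE /val_map /= /abs2.
by rewrite ![_ == z]eq_sym => /negPf-> /negPf->.
Qed.

Lemma atom_map_abs2P x y (a b : atom name) :
  atom_map (abs2 x y) a = atom_map shift2 b -> fresh2 x y a /\ a = b.
Proof.
case: a b => A vs [B ws] [-> {A} E].
suff [fr <-] : fresh2 x y (B, vs) /\ vs = ws by [].
rewrite /fresh2 /fv_atom /=.
elim: vs ws E => [|v vs IHvs] [|w ws] //= [Ev /IHvs[fr <-]].
rewrite !mem_cat !negb_or -!andbA.
have [-> -> ->] : [/\ x \notin fv_val v, y \notin fv_val v & v = w].
  case: v w Ev => [z|] [u|] //=; rewrite /abs2 !inE ![_ == z]eq_sym.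
  by case: (z =P y) => // _; case: (z =P x) => // _ [->].
by case/andP: fr => -> ->.
Qed.

(** As [abs2 x y] is injective, the atoms needed under the binder are the images of those needed by
    [P], and such an image is a weakening exactly when the atom is fresh for [x] and [y]. *)
Lemma balanced_nu x y T (P : proc name) :
  balanced (p_nu x y T P) <->
  balanced P /\ forall a, 0 < need P a -> fresh2 x y a.
Proof.
have I := @abs2_inj x y.
rewrite /p_nu /= (@balanced_map _ (option (option name)) _ _ I).
split=> -[bP closedP]; split=> // a a_gt0.
  have [] := closedP (atom_map (abs2 x y) a).
    by rewrite (@need_map _ (option (option name))).
  by move=> b /atom_map_abs2P[].
have [c ac] := @need_map_gt0 _ (option (option name)) _ _ _ a_gt0.
move: a_gt0; rewrite ac (@need_map _ (option (option name))) // => /closedP fr.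
by exists c; rewrite atom_map_abs2_fresh.
Qed.

(** At a fresh atom, abstraction agrees with weakening. At any other atom both sides are 0: the
    right one by balance, the left one because the weakened atom is not in the image of
    [abs2 x y]. *)
Lemma need_nu x y T (P : proc name) a :
  balanced (p_nu x y T P) -> need (p_nu x y T P) a = need P a.
Proof.
move=> /balanced_nu[_ closedP]; have I := @abs2_inj x y.
case fr: (fresh2 x y a).
  rewrite /p_nu /= -(atom_map_abs2_fresh fr).
  exact: (@need_map _ (option (option name))).
have -> : need P a = 0.
  by case: (posnP (need P a)) => // /closedP; rewrite fr.
case: (posnP (need (p_nu x y T P) a)) => //; rewrite /p_nu /=.
move=> /(@need_map_gt0 _ (option (option name)))[c /esym/atom_map_abs2P[+ ca]].
by rewrite ca fr.
Qed.

Local Opaque p_nu.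

(** * Heating *)

(** Balance enters the equality of needs twice: unrolling a replication adds the need of a copy,
    which must be 0, and [need_nu] speaks of balanced restrictions. *)
Lemma struct_ax_need P Q : struct_ax P Q ->
  (balanced P <-> balanced Q) /\ (balanced P -> need P =1 need Q).
Proof.
case=> {P Q} /=.
- by move=> P Q; split=> [|_ a]; [tauto | rewrite addnC].
- by move=> P Q R; split=> [|_ a]; [tauto | rewrite addnA].
- by move=> P; split=> [|_ a]; [tauto | rewrite addn0].
- by move=> P; split=> [|[_ P0] a]; [tauto | rewrite addn0 P0].
- move=> x y T _; suff b0 : balanced (p_nu x y T PNil).
    by split=> // _ a; rewrite (need_nu _ b0).
  exact/balanced_nu.
- move=> x y T P Q xQ yQ.
  have frQ a : 0 < need Q a -> fresh2 x y a.
    by move/need_fv => sub; rewrite /fresh2 (contra (sub x)) ?(contra (sub y)).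
  have E : balanced (p_nu x y T (PPar P Q)) <->
           balanced (PPar (p_nu x y T P) Q).
    rewrite /= !balanced_nu /=.
    split=> [[[bP bQ] fr]|[[bP fr] bQ]].
      by split=> //; split=> // a a_gt0; rewrite fr // addn_gt0 a_gt0.
    by split=> // a; rewrite addn_gt0 => /orP[/fr|/frQ].
  by split=> // b a; rewrite need_nu //= need_nu //; case/E: b.
- move=> w z x y T U P _ _ _.
  (* The axiom is symmetric in the two restrictions. *)
  suff half w' z' x' y' T' U' :
      balanced (p_nu w' z' T' (p_nu x' y' U' P)) ->
      balanced (p_nu x' y' U' (p_nu w' z' T' P)) /\
      need (p_nu w' z' T' (p_nu x' y' U' P)) =1
      need (p_nu x' y' U' (p_nu w' z' T' P)).
    by split; [split=> /half[] | move/half=> []].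
  move=> b; have [bxy frwz] := (balanced_nu _ _ _ _).1 b.
  have [bP frxy] := (balanced_nu _ _ _ _).1 bxy.
  have bwz : balanced (p_nu w' z' T' P).
    by apply/balanced_nu; split=> // a a_gt0; apply: frwz; rewrite need_nu.
  have b' : balanced (p_nu x' y' U' (p_nu w' z' T' P)).
    by apply/balanced_nu; split=> // a; rewrite need_nu // => /frxy.
  by split=> // a; rewrite !need_nu.
- move=> x y T phi P xphi yphi.
  have E : balanced (p_nu x y T (PAssume phi P)) <->
           balanced (PAssume phi (p_nu x y T P)).
    rewrite /= !balanced_nu /=.
    split=> -[bP fr]; split=> // a a_gt0.
      (* An atom that [phi] might cancel, and so conceal from [fr], has its variables in [phi] and
         is fresh by the side conditions. *)
      case: (posnP (atom_count a phi)) => [a0|/atom_count_fv sub].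
        by apply: fr; rewrite a0 subn0.
      by rewrite /fresh2 (contra (sub x)) ?(contra (sub y)).
    by apply: fr; move: a_gt0; rewrite subn_gt0; apply: leq_ltn_trans.
  by split=> // b a; rewrite need_nu //= need_nu //; apply/E.
- by move=> P; split=> // _ a; rewrite subn0.
- by move=> P; split=> // _ a; rewrite addn0.
- by move=> phi1 phi2 P; split=> // _ a; rewrite subnAC.
- by move=> phi1 phi2 P; split=> // _ a; rewrite addnAC.
- by move=> phi1 phi2 P; split=> // _ a; lia.
- by move=> phi1 phi2 P; split=> // _ a; lia.
- by move=> x y T U P _.
Qed.

Lemma heat_need P Q : heat P Q -> balanced P ->
  balanced Q /\ forall a, need Q a <= need P a.
Proof.
elim=> {P Q}.
- by [].
- move=> P Q R _ IHPQ _ IHQR /IHPQ[/IHQR[bR leRQ] leQP].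
  by split=> // a; apply: leq_trans (leQP a).
- move=> P Q /struct_ax_need[E eqPQ] bP.
  by split=> [|a]; [apply/E | rewrite eqPQ].
- move=> P Q /struct_ax_need[E eqPQ] /E bP.
  by split=> // a; rewrite eqPQ.
(* Here the need may drop: a surplus of [phi] over the need of [P], lost to truncation before
   heating, can now serve [Q]. *)
- by move=> phi P Q /= [bP bQ]; split=> // a; lia.
- by [].
- by [].
- move=> P P' Q Q' _ IHP _ IHQ /= [/IHP[bP leP] /IHQ[bQ leQ]].
  by split=> // a; apply: leq_add.
- move=> P Q _ IH /= [/IH[bQ leQ] P0]; split=> //; split=> // a.
  by apply/eqP; rewrite -leqn0 -(P0 a).
- move=> x y T P Q _ IH b.
  have [/IH[bQ leQ] fr] := (balanced_nu _ _ _ _).1 b.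
  have b' : balanced (p_nu x y T Q).
    by apply/balanced_nu; split=> // a a_gt0; apply/fr/(leq_trans a_gt0).
  by split=> // a; rewrite !need_nu.
- by move=> phi P Q _ IH /= /IH[bQ leQ]; split=> // a; apply: leq_sub2r.
- by move=> phi P Q _ IH /= /IH[bQ leQ]; split=> // a; rewrite leq_add2r.
Qed.

(** * Typing *)

(** Counts what repeated use of [tp_ref] can release from [x : T]. Refinements inside a session type
    or under [TMu] are out of its reach and count 0. *)
Fixpoint ref_count (a : atom name) (x : name) (T : ty name void) : nat :=
  if T is TRef T phi
  then ref_count a x T + atom_count a (form_inst phi (VVar x)) else 0.

Definition entry_count (a : atom name) (e : entry) : nat :=
  match e with
  | EVar x T => ref_count a x T
  | EForm phi => atom_count a phi
  end.

Definition ctx_count (a : atom name) (G : ctx) : nat :=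
  sumn (map (entry_count a) G).

Lemma ctx_count_append a G1 G2 :
  ctx_count a (append G1 G2) = ctx_count a G2 + ctx_count a G1.
Proof. by rewrite /ctx_count map_cat sumn_cat. Qed.

Lemma un_ty_count a x T : un_ty T -> ref_count a x T = 0.
Proof. by case: T. Qed.

Lemma dual_count a x T T' :
  dual T = Some T' -> ref_count a x T = 0 /\ ref_count a x T' = 0.
Proof.
case: T => //= [[<-]|q d T U|T] //.
  by case: (dual U) => //= ? [<-].
by case: (dual T) => //= ? [<-].
Qed.

Lemma un_ctx_count a G : un_ctx G -> ctx_count a G = 0.
Proof.
elim: G => //= -[x T|//] G IHG /andP[unT /IHG G0].
by rewrite /ctx_count /= un_ty_count.
Qed.

(** Formulae go to one side only, and an entry that is copied has an unrestricted type, which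
    carries no refinement at its root. *)
Lemma ctx_split_count a G G1 G2 : ctx_split G G1 G2 ->
  ctx_count a G = ctx_count a G1 + ctx_count a G2.
Proof.
elim=> {G G1 G2} //=; rewrite /ctx_count /= => G G1 G2 *;
  rewrite ?un_ty_count //; lia.
Qed.

(** Formulae are used linearly, and what is left over is unrestricted. Typing an assume uses that
    the count is at most that of [phi], typing an assert that it is at least that. *)
Lemma has_form_count a G phi : has_form G phi ->
  ctx_count a G = atom_count a phi.
Proof.
elim=> {G phi} /=.
- by move=> G _ /(un_ctx_count a).
- move=> G1 G2 phi _ /(un_ctx_count a).
  by rewrite !ctx_count_append /ctx_count /=; lia.
- by move=> G G1 G2 phi1 phi2 /(ctx_split_count a)-> _ -> _ ->.
Qed.

Lemma fv_form_inst (phi : form (option name)) (x : name) :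
  {subset fv_form (form_inst phi (VVar x)) <= x :: pmap id (fv_form phi)}.
Proof.
move=> y; rewrite inE mem_pmap map_id.
elim: phi => [A vs|phi1 IH1 phi2 IH2|] //=; last first.
  by rewrite !mem_cat => /orP[/IH1|/IH2] /orP[->|->]; rewrite ?orbT.
elim: vs => //= v vs IHvs; rewrite !mem_cat => /orP[|/IHvs]; last first.
  by case/orP=> ->; rewrite ?orbT.
by case: v => [[z|]|] //=; rewrite !inE => /eqP->; rewrite eqxx ?orbT.
Qed.

Lemma ref_count_fv a x T :
  0 < ref_count a x T -> {subset fv_atom a <= x :: fv_ty T}.
Proof.
move: T; fix IH 1; case=> //= T phi.
rewrite addn_gt0 => /orP[/(IH T)|/atom_count_fv] sub y /sub.
  by rewrite !inE mem_cat => /orP[->|->]; rewrite ?orbT.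
by move/fv_form_inst; rewrite !inE mem_cat => /orP[->|->]; rewrite ?orbT.
Qed.

(** Turns the variable convention of [tp_nu] into freshness of the needed atoms. *)
Lemma ctx_count_fv a G :
  0 < ctx_count a G -> {subset fv_atom a <= ctx_vars G}.
Proof.
elim: G => //= e G IHG; rewrite /ctx_count /= addn_gt0.
case/orP=> [|/IHG] sub y ya; rewrite /ctx_vars /= mem_cat; last first.
  by rewrite (sub y ya) orbT.
by case: e sub => [x T /ref_count_fv|phi /atom_count_fv] /(_ y ya)->.
Qed.

Lemma typed_need G P : typed G P ->
  balanced P /\ forall a, need P a <= ctx_count a G.
Proof.
elim=> {G P}.
- by [].
- move=> G G1 G2 P1 P2 sp _ [b1 le1] _ [b2 le2]; split=> // a.
  by rewrite (ctx_split_count a sp) leq_add.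
- move=> G x y T T' P _ xG yG _ dT _ [bP leP].
  (* The two new variables contribute nothing, since a type that has a dual is not a refinement, and
     neither is its dual. *)
  have {}leP a : need P a <= ctx_count a G.
    by have := leP a; have [] := dual_count a x dT; have [] := dual_count a y dT;
      rewrite /ctx_count /=; lia.
  have b : balanced (p_nu x y T P).
    apply/balanced_nu; split=> // a a_gt0.
    have /ctx_count_fv sub := leq_trans a_gt0 (leP a).
    by rewrite /fresh2 (contra (sub x)) ?(contra (sub y)).
  by split=> // a; rewrite need_nu.
- move=> G P unG _ [bP leP]; split=> //; split=> // a.
  by apply/eqP; rewrite -leqn0 -(un_ctx_count a unG).
(* Prefixes need nothing and are balanced whatever their continuation. *)
- by [].
- by [].
- move=> G G1 G2 phi P sp hphi _ [bP leP]; split=> // a.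
  have := leP a; rewrite (ctx_split_count a sp) (has_form_count a hphi) /=.
  by rewrite leq_subLR addnC.
- move=> G G1 G2 phi P sp hphi _ [bP leP]; split=> // a /=.
  rewrite (ctx_split_count a sp) (has_form_count a hphi) addnC.
  by rewrite leq_add2l.
- by [].
- move=> G1 G2 phi1 phi2 P _ [bP leP]; split=> // a.
  (* Taking a tensor apart leaves the count of the context unchanged; so does releasing a refinement
     in the next case. *)
  by have := leP a; rewrite !ctx_count_append /ctx_count /=; lia.
- move=> G1 G2 x T phi P _ [bP leP]; split=> // a.
  by have := leP a; rewrite !ctx_count_append /ctx_count /=; lia.
Qed.

(** * Canonical forms *)

Lemma nu_seq_need bs P : balanced (nu_seq bs P) ->
  need (nu_seq bs P) =1 need P.
Proof.
elim: bs => //= -[[x y] T] bs IHbs b a.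
by rewrite need_nu // IHbs //; case/balanced_nu: b.
Qed.

Lemma assume_seq_need (As : seq (form name)) P a :
  need (foldr (@PAssume name) P As) a =
  need P a - sumn (map (atom_count a) As).
Proof. by elim: As => /= [|phi As ->]; rewrite ?subn0 // subnDA subnAC. Qed.

Lemma par_seq_need (Ps : seq (proc name)) P a i :
  onth Ps i = Some P -> need P a <= need (par_seq Ps) a.
Proof.
case: Ps => [|Q Ps]; first by case: i.
rewrite /par_seq.
have -> : need (foldl (@PPar name) Q Ps) a =
          need Q a + sumn (map (fun R => need R a) Ps).
  elim: Ps Q {i} => [|R Ps IHPs] Q /=; first by rewrite addn0.
  by rewrite IHPs /= addnA.
case: i => [[->]|i /=]; first exact: leq_addr.
elim: Ps i => [|R Ps IHPs] [|i] //= => [[->]|/IHPs]; lia.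
Qed.

Lemma onth_atom_count (As : seq (form name)) A vs :
  all (@atomic name) As ->
  0 < sumn (map (atom_count ((A, vs) : atom name)) As) ->
  exists j, onth As j = Some (FAtom A vs).
Proof.
elim: As => //= -[A' vs'|//|//] As IHAs /= atAs; rewrite addn_gt0 lt0b.
case/orP=> [/eqP[-> ->]|/(IHAs atAs)[j Ej]]; first by exists 0.
by exists j.+1.
Qed.

Theorem theorem6 (G : ctx) (P : proc name) (hP : typed G P) (hG : un_ctx G) :
  safe P.
Proof.
move=> Q bs As Ps heatPQ [atAs _ _ defQ] i [A vs|//|//] R Psi _.
have [bP leP] := typed_need hP.
have [bQ leQ] := heat_need heatPQ bP.
apply: onth_atom_count atAs _; set a : atom name := (A, vs).
(* [Q] has no need of [a], so the assumes hold at least as many copies of [a] as the threads need;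
   the assert accounts for one. *)
have := leq_trans (leQ a) (leP a); rewrite un_ctx_count // leqn0 => /eqP Q0.
move: bQ Q0; rewrite defQ => bQ; rewrite nu_seq_need // assume_seq_need.
move/eqP; rewrite subn_eq0; apply: leq_trans.
apply: leq_trans (par_seq_need a Psi).
by rewrite /= eqxx addn1.
Qed.
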